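(* Let $p$ be a prime and $q$ a power of $p$. For every integer $n\ge 1$, the symplectic group $\mathrm{Sp}(2n,\overline{\mathbb{F}_q})$ is not acceptable.
   Context: $\overline{\mathbb{F}_q}$ denotes an algebraic closure of the finite field $\mathbb{F}_q$. Let $\Lambda_n$ be the $n\times n$ matrix with $1$'s on the antidiagonal and $0$ elsewhere, and $J=\begin{pmatrix}0&\Lambda_n\\-\Lambda_n&0\end{pmatrix}$. Then $\mathrm{Sp}(2n,\overline{\mathbb{F}_q})=\{A\in\mathrm{GL}(2n,\overline{\mathbb{F}_q}) : {}^tAJA=J\}$. Let $\Gamma$ be a group and $H$ a finite group. Two homomorphisms $\phi_1,\phi_2:H\to\Gamma$ are element-conjugate if for every $x\in H$ there is $h(x)\in\Gamma$ with $\phi_1(x)=h(x)^{-1}\phi_2(x)h(x)$; they are globally conjugate if one can choose a single $h\in\Gamma$ with $\phi_1(x)=h^{-1}\phi_2(x)h$ for all $x\in H$. The group $\Gamma$ is acceptable if for every finite group $H$, any two element-conjugate homomorphisms $H\to\Gamma$ are globally conjugate. *)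

(* Defs.v *)
From HB Require Import structures.
From mathcomp Require Import all_boot all_order all_algebra all_fingroup.

Set Implicit Arguments.
Unset Strict Implicit.
Unset Printing Implicit Defensive.

Import GRing.Theory.

Section Acceptable.

Local Open Scope group_scope.

Variable Gamma : groupType.

Definition element_conjugate (H : finGroupType)
    (phi1 phi2 : {multiplicative H -> Gamma}) : Prop :=
  forall x : H, exists h : Gamma, phi1 x = h^-1 * phi2 x * h.

Definition globally_conjugate (H : finGroupType)
    (phi1 phi2 : {multiplicative H -> Gamma}) : Prop :=
  exists h : Gamma, forall x : H, phi1 x = h^-1 * phi2 x * h.

Definition acceptable : Prop :=
  forall (H : finGroupType) (phi1 phi2 : {multiplicative H -> Gamma}),
    element_conjugate phi1 phi2 -> globally_conjugate phi1 phi2.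

End Acceptable.

Local Open Scope ring_scope.

(* A closedFieldType is algebraically closed by definition, so only the
   algebraicity of K over the image of F has to be required. *)
Definition is_algebraic_closure (F : fieldType) (K : closedFieldType)
    (iota : {rmorphism F -> K}) : Prop :=
  forall x : K, algebraicOver iota x.

Section Symplectic.

Variables (K : fieldType) (n : nat).

Definition antidiag_mx : 'M[K]_n := \matrix_(i, j) (j == rev_ord i)%:R.

Definition symplectic_form_mx : 'M[K]_(n + n) :=
  block_mx 0 antidiag_mx (- antidiag_mx) 0.

Local Notation J := symplectic_form_mx.

Definition symplectic_pred : pred 'M[K]_(n + n) :=
  fun A => (A \in unitmx) && (A^T *m J *m A == J).

Record Sp : Type := SpMatrix {
  Sp_mx :> 'M[K]_(n + n);
  Sp_mxP : symplectic_pred Sp_mx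
}.

HB.instance Definition _ := [isSub for Sp_mx].
HB.instance Definition _ := [Choice of Sp by <:].

Lemma Sp_one_proof : symplectic_pred 1%:M.
Proof. by rewrite /symplectic_pred unitmx1 trmx1 mul1mx mulmx1 eqxx. Qed.

Lemma Sp_mul_proof (A B : Sp) : symplectic_pred (Sp_mx A *m Sp_mx B).
Proof.
case: A B => [A /andP[uA /eqP hA]] [B /andP[uB /eqP hB]] /=.
rewrite /symplectic_pred unitmx_mul uA uB /= trmx_mul.
by rewrite -[B^T *m A^T *m J]mulmxA mulmxA -(mulmxA B^T) hA hB.
Qed.

Lemma Sp_inv_proof (A : Sp) : symplectic_pred (invmx (Sp_mx A)).
Proof.
case: A => [A /andP[uA /eqP hA]] /=.
rewrite /symplectic_pred unitmx_inv uA /= -[in X in X == _]hA trmx_inv.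
by rewrite -!mulmxA mulmxV // mulmx1 mulmxA mulVmx ?unitmx_tr ?mul1mx.
Qed.

Definition Sp_one : Sp := SpMatrix Sp_one_proof.
Definition Sp_mul (A B : Sp) : Sp := SpMatrix (Sp_mul_proof A B).
Definition Sp_inv (A : Sp) : Sp := SpMatrix (Sp_inv_proof A).

Lemma Sp_mulA : associative Sp_mul.
Proof. by move=> A B C; apply: val_inj; rewrite /= mulmxA. Qed.

Lemma Sp_mul1 : left_id Sp_one Sp_mul.
Proof. by move=> A; apply: val_inj; rewrite /= mul1mx. Qed.

Lemma Sp_mulr1 : right_id Sp_one Sp_mul.
Proof. by move=> A; apply: val_inj; rewrite /= mulmx1. Qed.

Lemma Sp_mulV : left_inverse Sp_one Sp_inv Sp_mul.
Proof.
by case=> A hA; apply: val_inj; rewrite /= mulVmx //; case/andP: hA.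
Qed.

Lemma Sp_mulrV : right_inverse Sp_one Sp_inv Sp_mul.
Proof.
by case=> A hA; apply: val_inj; rewrite /= mulmxV //; case/andP: hA.
Qed.

HB.instance Definition _ :=
  isGroup.Build Sp Sp_mulA Sp_mul1 Sp_mulr1 Sp_mulV Sp_mulrV.

End Symplectic.

(* Main.v *)
Require Import Defs.
From mathcomp Require Import all_boot all_order all_algebra all_fingroup.
From HB Require Import structures.
From mathcomp Require Import finfield.

(** The failure of acceptability comes from elementary abelian p-groups acting
    by unipotent matrices.  The scalar blocks [[a, b], [c, d]] with
    a d - b c = 1 give a copy of SL_2(K) in Sp(2n, K); let u(c) be the image of
    the unipotent matrix [[1, c], [0, 1]].  An additive map f : H -> K yields a
    homomorphism u o f.

    Since every element of K is a square, the diagonal torus of SL_2(K)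
    conjugates any two nontrivial u(c), u(d) (lemma
    [unipotent_conjugate]), so u o f1 and u o f2 are element-conjugate as soon
    as f1 and f2 are both injective.  On the other hand, an h that centralizes
    u(1) commutes with the nilpotent part of u, hence centralizes every u(c)
    (lemma [unipotent_rigid]); so if f1 and f2 agree with value 1 at one point
    and u o f1, u o f2 are globally conjugate, then f1 = f2.

    It remains to find two distinct injective additive maps with a common value
    1.  On H = F_p x F_p take (x, y) |-> x + y a, for a in K outside the prime
    field.  A root a of X^p = X + 1 will do, and so will a + 1, which is
    another root of that equation. *)

Set Implicit Arguments.
Unset Strict Implicit.
Unset Printing Implicit Defensive.

Import GRing.Theory.
Local Open Scope ring_scope.

(** * The scalar copy of SL_2 in the symplectic group *)

Section ScalarBlocks.

Variables (K : fieldType) (n : nat).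

Definition scalar_block_mx (a b c d : K) : 'M[K]_(n + n) :=
  block_mx a%:M b%:M c%:M d%:M.

Lemma scalar_block_mxM a b c d a' b' c' d' :
  scalar_block_mx a b c d *m scalar_block_mx a' b' c' d' =
  scalar_block_mx (a * a' + b * c') (a * b' + b * d')
                  (c * a' + d * c') (c * b' + d * d').
Proof. by rewrite mulmx_block -!scalar_mxM -!raddfD. Qed.

(** With J = [[0, L], [-L, 0]], scalar blocks commute with L, so the 2 x 2
    identity (t A) J A = (det A) J carries over verbatim. *)
Lemma scalar_block_mx_symplectic a b c d :
  a * d - b * c = 1 -> symplectic_pred (scalar_block_mx a b c d).
Proof.
move=> det1; apply/andP; split.
  suff /mulmx1_unit[] : scalar_block_mx a b c d *m
      scalar_block_mx d (- b) (- c) a = 1%:M by [].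
  rewrite scalar_block_mxM scalar_mx_block /scalar_block_mx !mulrN det1.
  rewrite [b * a]mulrC addNr [d * c]mulrC subrr addrC [d * a]mulrC.
  by rewrite [c * b]mulrC det1 !raddf0.
apply/eqP; rewrite tr_block_mx !tr_scalar_mx !mulmx_block.
rewrite !mulmx0 !add0r !addr0 !mulmxN !mul_scalar_mx !mulNmx !mul_mx_scalar.
rewrite !scalerA -!scaleNr -!scalerDl.
rewrite [c * a]mulrC [d * b]mulrC !addNr !scale0r.
rewrite [d * a]mulrC [_ + a * d]addrC [c * b]mulrC det1 scale1r.
by rewrite -[- (a * d) + _]opprK opprD opprK det1 scaleN1r.
Qed.

Definition scalar_block_Sp a b c d (det1 : a * d - b * c = 1) : Sp K n :=
  SpMatrix (scalar_block_mx_symplectic det1).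

Lemma unipotent_det1 c : 1 * 1 - c * 0 = 1 :> K.
Proof. by rewrite mulr0 subr0 mulr1. Qed.

Definition unipotent c : Sp K n := scalar_block_Sp (unipotent_det1 c).

Lemma unipotentD : {morph unipotent : c d / c + d >-> (c * d)%g}.
Proof.
move=> c d; apply: val_inj; rewrite /= scalar_block_mxM.
by rewrite !mul1r !mulr1 !mulr0 !mul0r !addr0 add0r addrC.
Qed.

Lemma conjugate_swap (x y h : Sp K n) :
  x = (h^-1 * y * h)%g <-> Sp_mx h *m Sp_mx x = Sp_mx y *m Sp_mx h.
Proof.
split=> [-> | e]; first by rewrite -[LHS]/(Sp_mx (h * (h^-1 * y * h))%g)
  !mulgA mulgV mul1g.
have /(canRL (mulKg h)) -> : (h * x = y * h)%g by apply: val_inj.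
by rewrite mulgA.
Qed.

(** Take h = diag(s, 1/s): then h u(c) h^-1 = u(c s^2). *)
Lemma unipotent_conjugate c d s :
  s != 0 -> c * s ^+ 2 = d ->
  exists h : Sp K n, unipotent c = (h^-1 * unipotent d * h)%g.
Proof.
move=> s0 <-; have det1 : s * s^-1 - 0 * 0 = 1 by rewrite mulr0 subr0 divff.
exists (scalar_block_Sp det1); apply/conjugate_swap.
rewrite /= !scalar_block_mxM !mulr0 !mul0r !mulr1 !mul1r !addr0 !add0r.
by rewrite -mulrA expr2 mulfK // mulrC.
Qed.

Definition nilpotent_block : 'M[K]_(n + n) := block_mx 0 1%:M 0 0.

Lemma unipotentE c : Sp_mx (unipotent c) = 1%:M + c *: nilpotent_block.
Proof.
rewrite /= /scalar_block_mx scalar_mx_block scale_block_mx add_block_mx.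
by rewrite !scaler0 !addr0 add0r scale_scalar_mx mulr1 raddf0.
Qed.

Lemma unipotent_conjugateE c d (h : Sp K n) :
  unipotent c = (h^-1 * unipotent d * h)%g ->
  c *: (Sp_mx h *m nilpotent_block) = d *: (nilpotent_block *m Sp_mx h).
Proof.
move/conjugate_swap; rewrite !unipotentE mulmxDl mulmxDr mul1mx mulmx1.
by move/addrI; rewrite -scalemxAl -scalemxAr.
Qed.

(** Write u(c) = 1 + c N.  If h commutes with u(1) it commutes with N, so that
    c h N = d N h = d h N; as h is invertible and N <> 0, c = d. *)
Lemma unipotent_rigid c d (h : Sp K n) :
  (0 < n)%N -> unipotent 1 = (h^-1 * unipotent 1 * h)%g ->
  unipotent c = (h^-1 * unipotent d * h)%g -> c = d.
Proof.
move=> n0 /unipotent_conjugateE; rewrite !scale1r => comm.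
move/unipotent_conjugateE; rewrite -comm => /eqP.
rewrite -subr_eq0 -scalerBl scaler_eq0 subr_eq0 => /orP[/eqP // | /eqP hN0].
have /andP[h_unit _] := Sp_mxP h.
have : nilpotent_block = 0.
  by rewrite -(mulKmx h_unit nilpotent_block) hN0 mulmx0.
move/(congr1 ursubmx); rewrite block_mxKur.
move/matrixP/(_ (Ordinal n0) (Ordinal n0)).
by rewrite !mxE eqxx => /eqP; rewrite oner_eq0.
Qed.

End ScalarBlocks.

(** * Additive maps from the plane over the prime field *)

Lemma closed_sqrt (K : closedFieldType) (x : K) : exists s, s ^+ 2 = x.
Proof.
have [s] := @solve_monicpoly K 2 (fun i => if i == 0%N then x else 0) isT.
by rewrite !big_ord_recl big_ord0 /= mul0r !addr0 mulr1; exists s.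
Qed.

Section PrimePlane.

Variables (K : fieldType) (p : nat).
Variables (p_pr : prime p) (pcharKp : p \in [pchar K]).

Definition plane_eval (a : K) (v : 'F_p * 'F_p) : K := v.1%:R + v.2%:R * a.

Lemma plane_eval10 a : plane_eval a (1, 0) = 1.
Proof. by rewrite /plane_eval mul0r addr0. Qed.

Lemma plane_eval01 a : plane_eval a (0, 1) = a.
Proof. by rewrite /plane_eval mul1r add0r. Qed.

Lemma Fp_natrD (x y : 'F_p) : (x + y)%R%:R = x%:R + y%:R :> K.
Proof.
rewrite -natrD -(GRing.natr_mod_pchar pcharKp (x + y)%N); congr _%:R => /=.
by congr (_ %% _)%N; apply: Fp_cast.
Qed.

Lemma plane_evalD a : {morph plane_eval a : v w / v + w}.
Proof.
by move=> [x y] [x' y']; rewrite /plane_eval !Fp_natrD mulrDl addrACA.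
Qed.

Lemma Fp_natr_eq0 (x : 'F_p) : (x%:R == 0 :> K) = (x == 0).
Proof.
rewrite -(dvdn_pcharf pcharKp) /dvdn modn_small ?[_ == 0 in RHS]/eq_op //.
by rewrite -{2}(Fp_cast p_pr).
Qed.

(** The Frobenius fixes the prime field and sends a to a + 1; applied to a
    relation x + y a = 0 it gives x + y (a + 1) = 0, whence y = 0. *)
Lemma plane_eval_eq0 a v : a ^+ p = a + 1 -> (plane_eval a v == 0) = (v == 0).
Proof.
case: v => x y ap; rewrite /plane_eval /=.
apply/eqP/eqP => [e | [-> ->]]; last by rewrite mul0r addr0.
have : pFrobenius_aut pcharKp (x%:R + y%:R * a) = 0 by rewrite e raddf0.
rewrite rmorphD rmorphM !rmorph_nat /= pFrobenius_autE ap mulrDr addrA e.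
rewrite add0r mulr1 => y0; move: e; rewrite y0 mul0r addr0 => /eqP.
by move/eqP: y0; rewrite !Fp_natr_eq0 => /eqP-> /eqP->.
Qed.

Variable n : nat.

Lemma unipotent_plane_evalM a :
  {morph (fun v : 'F_p * 'F_p => unipotent n (plane_eval a v)) :
     v w / (v * w)%g}.
Proof. by move=> v w; rewrite -unipotentD -plane_evalD. Qed.

Definition plane_unipotent a : {multiplicative 'F_p * 'F_p -> Sp K n} :=
  HB.pack (fun v : 'F_p * 'F_p => unipotent n (plane_eval a v))
    (isMultiplicative.Build _ _ _ (unipotent_plane_evalM a)).

End PrimePlane.

(** Provides elements outside the prime field in characteristic p: every x in
    the prime field satisfies x^p = x, never x^p = x + 1. *)
Lemma exists_artin_schreier_root (K : closedFieldType) p :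
  (1 < p)%N -> exists a : K, a ^+ p = a + 1.
Proof.
move=> p1; have p0 : (0 < p)%N by apply: ltnW.
(* The lower-order coefficients are 1 in degrees 0 and 1, and 0 above. *)
have [a ap] := @solve_monicpoly K p (fun i => (i < 2)%:R) p0.
exists a; rewrite ap; case: p p1 {p0 ap} => [|[|p]] // _.
rewrite !big_ord_recl /= big1 ?addr0 => [|i _]; last by rewrite mul0r.
by rewrite !mul1r expr0 expr1 addrC.
Qed.

(** * Failure of acceptability *)

Theorem theorem6p4 (p k q : nat) (hp : prime p) (hk : (0 < k)%N)
    (hq : q = (p ^ k)%N)
    (F : finFieldType) (hF : #|F| = q)
    (K : closedFieldType) (iota : {rmorphism F -> K})
    (hK : is_algebraic_closure iota)
    (n : nat) (hn : (0 < n)%N) :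
  ~ acceptable (Sp K n).
Proof.
have pcharKp : p \in [pchar K].
  by rewrite (fmorph_pchar iota) (card_finPcharP (etrans hF hq) hp).
have [a ap] := exists_artin_schreier_root K (prime_gt1 hp).
have a1p : (a + 1) ^+ p = a + 1 + 1.
  by rewrite -(pFrobenius_autE pcharKp) rmorphD rmorph1 /= pFrobenius_autE ap.
move/(_ _ (plane_unipotent hp pcharKp n a)
          (plane_unipotent hp pcharKp n (a + 1))).
case=> [v | h glob].
  have [-> | v0] := eqVneq v 0; last first.
    have nz (b : K) : b ^+ p = b + 1 -> plane_eval b v != 0.
      by move=> bp; rewrite (plane_eval_eq0 hp pcharKp _ bp).
    have [s s2] := closed_sqrt (plane_eval (a + 1) v / plane_eval a v).
    apply: (@unipotent_conjugate _ _ _ _ s).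
      by rewrite -sqrf_eq0 s2 mulf_neq0 ?invr_eq0 ?nz.
    by rewrite s2 mulrC divfK ?nz.
  exists 1%g; rewrite invg1 mul1g mulg1 /= /plane_eval /=.
  by rewrite !mul0r.
have a_fixed : a = a + 1.
  apply: unipotent_rigid hn _ _.
    by move: (glob (1, 0)); rewrite /= !plane_eval10; apply.
  by move: (glob (0, 1)); rewrite /= !plane_eval01; apply.
by move/eqP: a_fixed; rewrite -subr_eq0 opprD addNKr oppr_eq0 oner_eq0.
Qed.
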